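(* Let $X$, $Y$ be separable Banach spaces, $G \subset X$ an open set and $f: G \to Y$ an arbitrary mapping. Then there exists a $\sigma$-porous set $A \subset G$ such that, for each $x \in G \setminus A$, the following assertion holds: If $f$ is Lipschitz at $x$ and Fréchet differentiable at $x$ along a subspace $M^x$ of $X$ of finite codimension, and if there exists a set $S_x\subset X$ such that $\operatorname{span} S_x$ is dense in $X$ and the one-sided directional derivative $f'_+(x,u)$ exists for all $u \in S_x$, then $f$ is Fréchet differentiable at $x$.
   Context: All Banach spaces are real and nontrivial ($\neq\{0\}$), with norm denoted $|\cdot|$. A subspace of a Banach space means a closed linear subspace $\neq\{0\}$ (the whole space $X$ has codimension $0$). $B(x,r)$ is the open ball. For a subspace $V$ of $X$, $f$ is Fréchet differentiable at $x\in G$ along $V$ if the mapping $g(v):=f(x+v)$, $v\in V\cap(G-x)$, is Fréchet differentiable at $0\in V$. $f$ is Lipschitz at $x\in G$ if $\limsup_{y\to x}\frac{|f(y)-f(x)|}{|y-x|}<\infty$. The one-sided directional derivative is $f'_+(x,u):=\lim_{t\to 0+}\frac{f(x+tu)-f(x)}{t}$. A set $A\subset X$ is porous at $x\in X$ if there exists $c>0$ such that for each $\delta>0$ there exists $t\in B(x,\delta)\setminus\{x\}$ with $B(t,c|t-x|)\cap A=\emptyset$. $A$ is porous if it is porous at each of its points, and $\sigma$-porous if it is a countable union of porous sets. *)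

(* Defs.v *)
From HB Require Import structures.
From mathcomp Require Export all_boot all_order all_algebra.
From mathcomp Require Export all_classical all_reals all_analysis.

Set Implicit Arguments.
Unset Strict Implicit.
Unset Printing Implicit Defensive.

Import Order.TTheory GRing.Theory Num.Theory.
Export numFieldNormedType.Exports.

Local Open Scope classical_set_scope.
Local Open Scope ring_scope.

Definition separable_space (T : topologicalType) : Prop :=
  exists D : set T, countable D /\ dense D.

Definition nontrivial_space (R : realType) (X : normedModType R) : Prop :=
  exists x : X, x != 0.

Record subspace (R : realType) (X : normedModType R) := Subspace {
  subspace_set :> set X;
  subspace_submod : submod_closed [in subspace_set];
  subspace_closed : closed subspace_set;
  subspace_neq0 : exists2 x, subspace_set x & x != 0 }.

(* A subspace is itself a normed space, with the norm inherited from X, so that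
   [differentiable] applies to maps defined on it. *)
Section SubspaceNormedModule.
Context (R : realType) (X : normedModType R) (V : subspace X).

Definition subspace_pred : {pred X} := [in (V : set X)].

HB.instance Definition _ :=
  GRing.isSubmodClosed.Build R X subspace_pred (subspace_submod V).

Record subspace_type := SubspaceElt {
  subspace_val :> X;
  _ : subspace_val \in subspace_pred }.

HB.instance Definition _ := [isSub for subspace_val].
HB.instance Definition _ := [Choice of subspace_type by <:].
HB.instance Definition _ := [SubChoice_isSubLmodule of subspace_type by <:].

Let norm (v : subspace_type) : R := `|subspace_val v|.

Let ler_normD (u v : subspace_type) : norm (u + v) <= norm u + norm v.
Proof. exact: ler_normD. Qed.

Let normrZ (a : R) (v : subspace_type) : norm (a *: v) = `|a| * norm v.
Proof. exact: normrZ. Qed.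

Let normr0_eq0 (v : subspace_type) : norm v = 0 -> v = 0.
Proof. by move=> v0; apply: val_inj; apply: normr0_eq0. Qed.

HB.instance Definition _ :=
  Lmodule_isNormed.Build R subspace_type ler_normD normrZ normr0_eq0.

End SubspaceNormedModule.

(* X / V is spanned by the classes of finitely many vectors *)
Definition finite_codim (R : realType) (X : normedModType R)
    (V : subspace X) : Prop :=
  exists (n : nat) (e : 'I_n -> X), forall x : X,
    exists c : 'I_n -> R, subspace_set V (x - \sum_(i < n) c i *: e i).

Definition linear_span (R : realType) (X : normedModType R) (S : set X) :
    set X :=
  [set x | exists (n : nat) (c : 'I_n -> R) (s : 'I_n -> X),
     (forall i, S (s i)) /\ x = \sum_(i < n) c i *: s i].

(* A mapping f : G -> Y on an open set G is represented by a total function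
   X -> Y.  The three notions below depend, for x in G, only on the values of f
   on G (they only see f near x), hence not on the chosen extension. *)
Section LocalNotions.
Context (R : realType) (X Y : normedModType R).
Implicit Types (f : X -> Y) (x u : X).

Definition differentiable_along (V : subspace X) f x : Prop :=
  differentiable (fun v : subspace_type V => f (x + subspace_val v))
    (0 : subspace_type V).

Definition lipschitz_at f x : Prop :=
  (limf_esup (fun y => (`|f y - f x| / `|y - x|)%:E) x^' < +oo)%E.

Definition ex_right_dirderiv f x u : Prop :=
  cvg (t^-1 *: (f (x + t *: u) - f x) @[t --> (0 : R)^'+]).

End LocalNotions.

Section Porosity.
Context (R : realType) (X : normedModType R).

Definition porous_at (A : set X) (x : X) : Prop :=
  exists2 c : R, 0 < c & forall d : R, 0 < d ->
    exists t : X, [/\ ball x d t, t != x & ball t (c * `|t - x|) `&` A = set0].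

Definition porous (A : set X) : Prop := forall x, A x -> porous_at A x.

Definition sigma_porous (A : set X) : Prop :=
  exists P : nat -> set X, (forall n, porous (P n)) /\ A = \bigcup_n P n.

End Porosity.

(* Main.v *)
From HB Require Import structures.
Require Import Defs.
From mathcomp Require Import ring lra.

(** The key step is an increment formula: if [z = f'_+(x, u)] then, off a
    sigma-porous set, [f (x + h + t u) - f (x + h) = t z + o(|h| + |t|)].
    Call [a] controlled if [f] has Lipschitz constant [k] at [a] and
    [f (a + t v) - f a] is within [eta t] of [t z] for some [v] near [u], both
    uniformly at scale [r].  If the set of controlled points is not porous at
    [x], there are controlled points [a] close to [x + h] and [b] close to
    [x + h + t u]; the Lipschitz condition at [a] compares [f a] with
    [f (x + h)], the one at [b] compares [f b] with both [f (a + t v)] and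
    [f (x + h + t u)].  For [t < 0] the roles of [a] and [b] are exchanged,
    which is why one-sided derivatives suffice.  Separability reduces the
    parameters to countably many.  Consequently a first-order expansion of [f]
    along a closed subspace [W] extends to [W + R u], and finite codimension
    lets this reach the whole space in finitely many steps. *)

Set Implicit Arguments.
Unset Strict Implicit.
Unset Printing Implicit Defensive.

Import Order.TTheory GRing.Theory Num.Theory.

Local Open Scope classical_set_scope.
Local Open Scope ring_scope.

(** * Porosity and separability *)

Section Porosity.
Context (R : realType) (X : normedModType R).

Lemma porous_at_subset (A B : set X) (x : X) :
  A `<=` B -> porous_at B x -> porous_at A x.
Proof.
move=> AB [c c0 cB]; exists c => // d /cB[t [xt tx tB]].
by exists t; split=> //; rewrite -subset0 -tB; apply: setIS.
Qed.

Lemma sigma_porous_bigcup (I : countType) (P : I -> set X) :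
  (forall i, porous (P i)) -> sigma_porous (\bigcup_i P i).
Proof.
(* Codes that decode to nothing receive the empty set, which is vacuously porous. *)
move=> pP; exists (fun n => if unpickle n is Some i then P i else set0); split.
  by move=> n; case: unpickle.
apply/seteqP; split=> x [i _ Pix]; last first.
  by move: Pix; case: unpickle => // j; exists j.
by exists (pickle i); rewrite // pickleK.
Qed.

(** Porosity only tests centres other than [x]; at [y = x] the point [a = x] serves, thanks to
    [A x]. *)
Lemma not_porous_atP (A : set X) (x : X) : A x -> ~ porous_at A x ->
  forall c, 0 < c -> exists2 d, 0 < d &
    forall y, `|y - x| < d -> exists2 a, A a & `|a - y| <= c * `|y - x|.
Proof.
move=> Ax NpA c c0; apply: contrapT => /forall2NP Nd; apply: NpA.
exists c => // d d0.
have [/(_ d0)//|/existsNP[y /not_implyP[xy /forall2NP NA]]] :=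
  Nd d.
have yx : y != x.
  apply/eqP => yx; have [/(_ Ax)//|] := NA x.
  by rewrite yx subrr normr0 mulr0.
exists y; split=> //; first by rewrite -ball_normE/= distrC.
apply/seteqP; split=> // a [ya Aa]; have [/(_ Aa)//|] := NA a; apply.
by move: ya; rewrite -ball_normE/= distrC => /ltW.
Qed.

End Porosity.

Lemma separable_dense_sequence (R : realType) (X : normedModType R) :
  separable_space X ->
  exists s : nat -> X, forall x e, 0 < e -> exists n, `|x - s n| < e.
Proof.
move=> [D [/countable_injP[g gI] dD]].
(* [xget] inverts the injection [g] of [D] into [nat]; an index outside its image yields 0, which is
   harmless. *)
exists (fun n => xget 0 [set x | D x /\ g x = n]) => x e e0.
have [|y [xy Dy]] := dD (ball x e) _ (ball_open x e).
  by exists x; apply: ballxx.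
exists (g y); case: xgetP => [z _ [Dz gz]|/(_ y)[]]; last by split.
have -> : z = y by apply: gI; rewrite ?inE.
by move: xy; rewrite -ball_normE.
Qed.

(** * Adjoining a line to a closed linear subspace *)

Section Submodules.
Context (R : realType) (X : normedModType R).
Implicit Types (W : set X) (u v w : X).

Definition submodule W :=
  W 0 /\ forall (a : R) v w, W v -> W w -> W (a *: v + w).

Definition adjoin_line W u : set X := [set v | exists t : R, W (v - t *: u)].

Lemma submoduleZ W a v : submodule W -> W v -> W (a *: v).
Proof. by move=> [W0 WD] Wv; rewrite -[_ *: _]addr0; apply: WD. Qed.

Lemma submoduleD W v w : submodule W -> W v -> W w -> W (v + w).
Proof. by move=> [W0 WD] Wv Ww; rewrite -[v]scale1r; apply: WD. Qed.

Lemma submoduleB W v w : submodule W -> W v -> W w -> W (v - w).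
Proof.
move=> Wm Wv Ww; rewrite -scaleN1r; apply: submoduleD => //.
exact: submoduleZ.
Qed.

Lemma linear_span_submodule W : submodule W -> linear_span W `<=` W.
Proof.
move=> Wm x [n [c [s [Ws ->]]]]; elim/big_ind: _ => [|v w|i _].
- exact: Wm.1.
- exact: submoduleD.
- exact: submoduleZ.
Qed.

Lemma submodule_adjoin_line W u : submodule W -> submodule (adjoin_line W u).
Proof.
move=> Wm; split; first by exists 0; rewrite scale0r subr0; apply: Wm.1.
move=> a v w [s Ws] [t Wt]; exists (a * s + t).
rewrite scalerDl -scalerA opprD addrACA -scalerBr; exact: Wm.2.
Qed.

(** A ball of radius [r] around [u] misses [W]. If [w + t *: u] were shorter than [r * |t|],
    dividing by [t] would put a point of [W] into that ball. *)
Lemma closed_submodule_dist W u : closed W -> submodule W -> ~ W u ->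
  exists2 r : R, 0 < r & forall w t, W w -> r * `|t| <= `|w + t *: u|.
Proof.
move=> Wc Wm NWu.
have /open_nbhs_nbhs/nbhs_ballP[r /= r0 rW] : open_nbhs u (~` W).
  by split=> //; apply: closed_openC.
exists r => // w t Ww.
have [->|t0] := eqVneq t 0; first by rewrite normr0 mulr0.
rewrite leNgt; apply/negP => lt_r.
apply: (rW (- t^-1 *: w)); last exact: submoduleZ.
rewrite -ball_normE/= scaleNr opprK -(@ltr_pM2r _ `|t|) ?normr_gt0//.
rewrite mulrC -normrZ scalerDr scalerA divff// scale1r addrC; exact: lt_r.
Qed.

(** Here [l] is the coordinate along [u]; the distance bound applied to differences makes it unique
    and Lipschitz. *)
Lemma adjoin_line_coordinate W u : closed W -> submodule W -> ~ W u ->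
  exists (l : X -> R) (r : R), [/\ 0 < r,
    forall v, adjoin_line W u v -> W (v - l v *: u),
    forall v t, W (v - t *: u) -> l v = t &
    forall v w, adjoin_line W u v -> adjoin_line W u w ->
      r * `|l v - l w| <= `|v - w|].
Proof.
move=> Wc Wm NWu; have [r r0 rW] := closed_submodule_dist Wc Wm NWu.
have uniq v s t : W (v - s *: u) -> W (v - t *: u) -> s = t.
  move=> Ws Wt; apply/eqP; rewrite -subr_eq0 -normr_le0 -(pmulr_rle0 _ r0).
  have := rW _ (s - t) (submoduleB Wm Ws Wt).
  by rewrite opprB scalerBl [_ + (_ - v)]addrC subrKA subrKA subrr normr0.
pose l v := xget 0 [set t : R | W (v - t *: u)]; exists l, r.
have Wl v : adjoin_line W u v -> W (v - l v *: u).
  by move=> [t Wt]; rewrite /l; case: xgetP => [s _|/(_ t)].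
split=> // [v t Wt|v w Wv Ww].
  by apply: (uniq v) => //; apply: Wl; exists t.
apply: le_trans (rW _ (l v - l w) (submoduleB Wm (Wl _ Wv) (Wl _ Ww))) _.
by rewrite opprB scalerBl addrACA subrK [X in X - _ *: u]addrC addrK.
Qed.

(** If [u] is outside [W], the Lipschitz coordinate is Cauchy along points of the sum tending to
    [y]. Its limit is a coordinate for [y], because [W] is closed. *)
Lemma closed_adjoin_line W u :
  closed W -> submodule W -> closed (adjoin_line W u).
Proof.
move=> Wc Wm; have [Wu|NWu] := pselect (W u).
  rewrite (_ : adjoin_line W u = W)//; apply/seteqP; split=> [v [t Wv]|v Wv].
    rewrite -(subrK (t *: u) v); apply: submoduleD => //; exact: submoduleZ.
  by exists 0; rewrite scale0r subr0.
have [l [r [r0 Wl _ lr]]] := adjoin_line_coordinate Wc Wm NWu.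
move=> y yW; set V := adjoin_line W u in yW Wl lr *.
pose F := within V (nbhs y).
have FF : ProperFilter F by apply: within_nbhs_proper.
have lF : cvg (l @ F).
  apply: cauchy_cvg; apply: cauchy_exP => e e0.
  have er0 : 0 < e * r / 2 by rewrite !mulr_gt0// invr_gt0.
  have [v [Vv yv]] := yW _ (nbhsx_ballx y _ er0).
  exists (l v); apply: (@filterS _ (nbhs y)) (nbhsx_ballx y _ er0) => w yw Vw.
  rewrite /= -ball_normE/= -(ltr_pM2l r0).
  apply: (le_lt_trans (lr _ _ Vv Vw)); rewrite (splitr (r * e)).
  have -> : v - w = (v - y) + (y - w) by rewrite addrA subrK.
  apply: (le_lt_trans (ler_normD _ _)); rewrite [r * e]mulrC ltrD//.
    by move: yv; rewrite -ball_normE/= distrC.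
  by move: yw; rewrite -ball_normE.
exists (lim (l @ F)).
apply: (@closed_cvg _ _ F FF (fun v => v - l v *: u) W) => //.
  exact: (@filterE _ (nbhs y) _ _ Wl).
apply: cvgB; first exact: cvg_within.
exact: cvgZr_tmp.
Qed.

End Submodules.

(** * First-order expansions *)

Section Expansions.
Context (R : realType) (X Y : normedModType R).
Implicit Types (f : X -> Y) (x u : X) (W : set X).

(** Continuity of [T] is not demanded; [expansion_differentiable] recovers it from the Lipschitz
    condition. *)
Definition expansion_along W f x := exists T : X -> Y,
  (forall a v w, W v -> W w -> T (a *: v + w) = a *: T v + T w) /\
  forall e, 0 < e -> exists2 d, 0 < d &
    forall w, W w -> `|w| < d -> `|f (x + w) - f x - T w| <= e * `|w|.

Lemma lipschitz_at_bound f x : lipschitz_at f x ->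
  exists (k : nat) (r : R), 0 < r /\
    forall y, `|y - x| < r -> `|f y - f x| <= k%:R * `|y - x|.
Proof.
move=> /ereal_inf_lt[_ [V xV <-]] supV.
have [r /= r0 rV] : exists2 r : R, 0 < r &
    ball x r `<=` [set y | y != x -> V y].
  by move: xV => /nbhs_ballP[r r0 rV]; exists r.
have [k supk] : exists k : nat,
    forall y, V y -> `|f y - f x| / `|y - x| <= k%:R.
  have ub y : V y -> ((`|f y - f x| / `|y - x|)%:E <=
      ereal_sup [set (`|f z - f x| / `|z - x|)%:E | z in V])%E.
    by move=> Vy; apply: ereal_sup_ubound; exists y.
  (* A supremum equal to -oo means that [V] is empty, so any [k] works. *)
  case: ereal_sup supV ub => [s _|//|_] ub; last by exists 0%N => y /ub.
  exists (Num.bound `|s|) => y /ub; rewrite lee_fin => /le_trans; apply.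
  by rewrite (le_trans (ler_norm s))// ltW// archi_boundP.
exists k, r; split=> // y yr; have [->|yx] := eqVneq y x.
  by rewrite !subrr !normr0 mulr0.
rewrite -ler_pdivrMr ?normr_gt0 ?subr_eq0//; apply: supk; apply: rV => //.
by rewrite -ball_normE/= distrC.
Qed.

Lemma right_dirderiv_expansion f x u : ex_right_dirderiv f x u ->
  exists z : Y, forall e, 0 < e -> exists2 d, 0 < d &
    forall t, 0 < t < d -> `|f (x + t *: u) - f x - t *: z| <= e * t.
Proof.
move=> /cvg_ex[z /cvgrPdist_le fz]; exists z => e /fz[d /= d0 dz].
exists d => // t /andP[t0 td].
have := dz t; rewrite /= sub0r normrN gtr0_norm// => /(_ td t0).
rewrite distrC => h; rewrite -(@ler_pM2l _ t^-1) ?invr_gt0//.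
rewrite -[X in X * `|_|]gtr0_norm ?invr_gt0// -normrZ scalerBr scalerA.
by rewrite mulVf ?gt_eqF// scale1r mulrCA mulVf ?gt_eqF// mulr1.
Qed.

Lemma differentiable_along_expansion (V : subspace X) f x :
  differentiable_along V f x -> expansion_along V f x.
Proof.
rewrite /differentiable_along; set g := fun v => _ => /diff_locallyP[_].
move=> /eqaddoP gd.
(* Inverse of [subspace_val], with value 0 off [V]; it turns the differential into a total map on
   [X]. *)
pose s (v : X) : subspace_type V := insubd 0 v.
have sK v : subspace_set V v -> subspace_val (s v) = v.
  by move=> Vv; rewrite -[LHS]/(val (s v)) insubdK// inE.
exists (fun v => 'd g 0 (s v)); split=> [a v w Vv Vw|e e0].
  rewrite -linearP; congr ('d g 0 _); apply: val_inj => /=.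
  rewrite [RHS](linearP (val : subspace_type V -> X))/= [LHS]sK ?sK//.
  by have := subspace_submod V; move=> [_ /(_ a v w)]; rewrite !inE; apply.
have /nbhs_ballP[d /= d0 dg] := gd _ e0.
exists d => // w Vw wd; have := dg (s w); rewrite -ball_normE/= sub0r normrN.
rewrite /g /= -[`|s w|]/(`|subspace_val (s w)|) sK// => /(_ wd).
by rewrite !fctE/= addr0 sK// addr0 opprD addrA.
Qed.

Lemma expansion_differentiable f x : lipschitz_at f x ->
  expansion_along setT f x -> differentiable f x.
Proof.
move=> /lipschitz_at_bound[k [r [r0 fk]]] [T [Tlin fT]].
have TL : linear T by move=> a v w; apply: Tlin.
pose TT := GRing.isLinear.Build R X Y _ T TL.
pose T' : {linear X -> Y} := HB.pack T TT.
have Tc : continuous T'.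
  (* Near 0, [|T w|] is at most [k * |w|] from the Lipschitz bound plus [|w|] from the expansion
     error with [e = 1]. *)
  apply/linear_bounded_continuous/ex_bound; exists ((k%:R + 1) * r).
  have [d d0 dT] := fT _ ltr01.
  apply/nbhs_norm0P; exists (Num.min d r); rewrite /= ?lt_min ?d0// => w /=.
  rewrite lt_min => /andP[wd wr]; have := dT w I wd.
  have := fk (x + w); rewrite [x + w]addrC addrK => /(_ wr) fw Tw.
  have := ler_distD (f (w + x) - f x) (T w) 0.
  rewrite !subr0 distrC => Tle; apply: (le_trans Tle).
  apply: (@le_trans _ _ ((k%:R + 1) * `|w|)); first lra.
  by rewrite ler_wpM2l ?addr_ge0// ltW.
have TE : f \o shift x = cst (f x) + T' +o_ 0 id.
  apply/eqaddoP => e e0; have [d d0 dT] := fT _ e0.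
  apply/nbhs_norm0P; exists d => // w /= wd; have := dT w I wd.
  by rewrite !fctE/= opprD addrA [w + x]addrC.
by apply/diff_locallyP; rewrite (diff_unique Tc TE).
Qed.

End Expansions.

(** * Increments near a point where the controlled set is not porous *)

Section Estimate.
Context (R : realType) (X Y : normedModType R) (f : X -> Y).
Implicit Types (x u v : X) (k : nat) (r eta : R).

(** The direction [v] may vary with the point; this lets [u] be restricted to a countable dense
    set. *)
Definition controlled k r eta u (z : Y) : set X := [set x |
  (forall y, `|y - x| < r -> `|f y - f x| <= k%:R * `|y - x|) /\
  exists2 v, `|v - u| <= eta &
    forall t, 0 <= t < r -> `|f (x + t *: v) - f x - t *: z| <= eta * t].

(** The path from [p] to [q] runs through [a], [a + t *: v] and [b]. Three Lipschitz steps have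
    lengths [ka], [2 * ka + 2 * eta * t] and [ka], the middle one because [v] and [u'] both lie
    within [eta] of [u]; the step from [a] costs [eta * t]. *)
Lemma controlled_increment k r eta u z u' a b p t ka :
  controlled k r eta u z a -> controlled k r eta u z b ->
  `|u' - u| <= eta -> 0 <= t < r -> 0 <= ka -> 2 * ka + 2 * eta * t < r ->
  `|a - p| <= ka -> `|b - (p + t *: u')| <= ka ->
  `|f (p + t *: u') - f p - t *: z| <= 4 * k%:R * ka + (2 * k%:R + 1) * eta * t.
Proof.
move=> [fa [v vu fav]] [fb _] u'u tr ka0 kar ap bq.
set q := p + t *: u' in bq *.
have t0 : 0 <= t by case/andP: tr.
have eta0 : 0 <= eta := le_trans (normr_ge0 _) u'u.
have et0 : 0 <= eta * t by apply: mulr_ge0.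
have k0 : 0 <= k%:R :> R by [].
have pa : `|f p - f a| <= k%:R * ka.
  have pa : `|p - a| <= ka by rewrite distrC.
  by apply: (le_trans (fa _ _)); [lra|rewrite ler_wpM2l].
have qb : `|f q - f b| <= k%:R * ka.
  have qb : `|q - b| <= ka by rewrite distrC.
  by apply: (le_trans (fb _ _)); [lra|rewrite ler_wpM2l].
have ab : `|f (a + t *: v) - f b| <= k%:R * (2 * ka + 2 * eta * t).
  have ab : `|a + t *: v - b| <= 2 * ka + 2 * eta * t.
    have -> : a + t *: v - b = (a - p) + (q - b) + t *: ((v - u) - (u' - u)).
      rewrite opprB subrKA scalerBr -[q - b]addrA subrKA [X in _ = X + _]addrCA.
      by rewrite [RHS]addrC subrKA addrCA addrA.
    apply: (le_trans (ler_normD _ _)).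
    apply: (@le_trans _ _ (ka + ka + t * (eta + eta))); last lra.
    apply: lerD.
      apply: (le_trans (ler_normD _ _)); apply: lerD => //; by rewrite distrC.
    rewrite normrZ ger0_norm// ler_wpM2l//.
    by apply: (le_trans (ler_normB _ _)); apply: lerD.
  by apply: (le_trans (fb _ _)); [lra|rewrite ler_wpM2l].
have av := fav t tr.
have -> : f q - f p - t *: z = (f q - f b) - (f (a + t *: v) - f b) +
    (f (a + t *: v) - f a - t *: z) - (f p - f a).
  rewrite opprB subrKA -[f _ - f a - _]addrA subrKA opprB [- f a - _]addrC.
  by rewrite [f q + (_ - _)]addrA subrKA addrAC.
apply: (le_trans (ler_normB _ _)).
apply: (@le_trans _ _
  (k%:R * ka + k%:R * (2 * ka + 2 * eta * t) + eta * t + k%:R * ka)); last lra.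
apply: lerD => //; apply: (le_trans (ler_normD _ _)); apply: lerD => //.
by apply: (le_trans (ler_normB _ _)); apply: lerD.
Qed.

Lemma controlled_estimate k r eta u z u' x e : 0 < r -> 0 < e ->
  controlled k r eta u z x -> ~ porous_at (controlled k r eta u z) x ->
  `|u' - u| <= eta ->
  exists2 d, 0 < d & forall h t, `|h| < d -> `|t| < d ->
    `|f (x + h + t *: u') - f (x + h) - t *: z| <=
      (2 * k%:R + 1) * eta * `|t| + e * (`|h| + `|t|).
Proof.
move=> r0 e0 Ax NpA u'u.
have eta0 : 0 <= eta := le_trans (normr_ge0 _) u'u.
have k0 : 0 <= k%:R :> R by [].
pose B := 1 + `|u'|.
have B1 : 1 <= B by rewrite lerDl.
(* Both endpoints lie within [B * (|h| + |t|)] of [x], so [ka] will be [c * B * (|h| + |t|)]; this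
   [c] gives [4 * k * ka <= e * (|h| + |t|)]. *)
pose c := e / (4 * (k%:R + 1) * B).
have c0 : 0 < c by rewrite /c divr_gt0// !mulr_gt0//; lra.
have [d1 d10 dA] := not_porous_atP Ax NpA c0.
(* The first bound keeps the endpoints in the range of nonporosity, the second keeps
   [2 * ka + 2 * eta * |t|] below [r]. *)
pose d := Num.min (d1 / (2 * B)) (r / (8 * (1 + c) * (1 + eta) * B)).
have dd1 : d * (2 * B) <= d1.
  by rewrite -ler_pdivlMr ?ge_min ?lexx//; lra.
have ddr : d * (8 * (1 + c) * (1 + eta) * B) <= r.
  by rewrite -ler_pdivlMr ?ge_min ?lexx ?orbT// !mulr_gt0//; lra.
have d0 : 0 < d.
  by rewrite lt_min !divr_gt0// !mulr_gt0//; lra.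
exists d => // h t hd td.
have near y : `|y - x| <= B * (`|h| + `|t|) ->
    exists2 a, controlled k r eta u z a & `|a - y| <= c * (B * (`|h| + `|t|)).
  move=> yx; have [|a Aa ay] := dA y; first by apply: (le_lt_trans yx); nra.
  by exists a => //; apply: (le_trans ay); rewrite ler_pM2l.
have u'0 := normr_ge0 u'; have h0 := normr_ge0 h; have t0 := normr_ge0 t.
have [|a0 Aa0 a0x] := near (x + h).
  rewrite [x + h]addrC addrK; nra.
have [|a1 Aa1 a1x] := near (x + h + t *: u').
  rewrite -[x + h + _]addrA [x + _]addrC addrK.
  apply: (le_trans (ler_normD _ _)).
  by rewrite normrZ /B; nra.
have B0 : 0 <= B by lra.
have ka0 : 0 <= c * (B * (`|h| + `|t|)).
  by rewrite (mulr_ge0 (ltW c0))// (mulr_ge0 B0)// addr_ge0.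
have cB : 4 * k%:R * (c * (B * (`|h| + `|t|))) <= e * (`|h| + `|t|).
  have -> : e * (`|h| + `|t|) = 4 * (k%:R + 1) * (c * (B * (`|h| + `|t|))).
    by rewrite /c; field; rewrite gt_eqF//=; lra.
  by rewrite ler_wpM2r//; lra.
have [Q Qr [Q1 Qc Qeta]] : exists2 Q, 8 * Q * d <= r &
    [/\ 1 <= Q, c * B <= Q & eta <= Q].
  exists ((1 + c) * (1 + eta) * B); first lra.
  have etaB : eta <= eta * B by rewrite ler_peMr.
  have cB0 : 0 <= c * B by rewrite mulr_ge0// ltW.
  have : (1 + c + eta) * B <= (1 + c) * (1 + eta) * B.
    by rewrite ler_wpM2r//; nra.
  by split; lra.
have tr : `|t| < r by nra.
have kar : 2 * (c * (B * (`|h| + `|t|))) + 2 * eta * `|t| < r.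
  have : (c * B) * (`|h| + `|t|) <= Q * (d + d).
    by apply: ler_pM; rewrite ?addr_ge0//; [rewrite mulr_ge0// ltW|lra].
  have : eta * `|t| <= Q * d by apply: ler_pM => //; exact: ltW.
  have : 0 < Q * d by rewrite mulr_gt0//; lra.
  lra.
rewrite [X in _ <= X]addrC.
apply: (@le_trans _ _ (4 * k%:R * (c * (B * (`|h| + `|t|))) +
    (2 * k%:R + 1) * eta * `|t|)); last by rewrite lerD2r.
have [tge|tlt] := leP 0 t.
  rewrite ger0_norm// in tr kar ka0 a0x a1x *.
  by apply: (controlled_increment Aa0 Aa1) => //; rewrite tge.
have tN : `|t| = - t by rewrite ltr0_norm.
(* The positive step [- t] leads from [x + h + t *: u'] back to [x + h]. *)
have := @controlled_increment k r eta u z u' a1 a0 (x + h + t *: u') (- t) _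
  Aa1 Aa0 u'u _ ka0.
rewrite !scaleNr addrK -tN t0 tr opprK => /(_ isT kar a1x a0x).
by rewrite -[in X in _ -> X]normrN !opprD !opprK [- f _ + _]addrC.
Qed.

End Estimate.

Lemma exists_invS_lt (R : realType) (e : R) : 0 < e ->
  exists n : nat, n.+1%:R^-1 < e.
Proof.
move=> e0; exists (Num.bound e^-1); rewrite invf_plt ?posrE//.
by rewrite (lt_trans (archi_boundP _))// ?invr_ge0 ?ltr_nat// ltW.
Qed.

(** * Extending expansions at a point outside the exceptional set *)

Section Increments.
Context (R : realType) (X Y : normedModType R) (f : X -> Y).
Context (D : nat -> X) (E : nat -> Y).
Context (D_dense : forall x (e : R), 0 < e -> exists n, `|x - D n| < e).
Context (E_dense : forall y (e : R), 0 < e -> exists n, `|y - E n| < e).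

Definition controlled_piece (i : nat * nat * nat * nat * nat) : set X :=
  let: (k, n, m, a, b) := i in
  controlled f k n.+1%:R^-1 m.+1%:R^-1 (D a) (E b).

Context (x : X).
Context (x_lip : lipschitz_at f x).
Context (x_generic :
  forall i, controlled_piece i x -> ~ porous_at (controlled_piece i) x).

Lemma generic_increment u : ex_right_dirderiv f x u ->
  exists z : Y, forall e, 0 < e -> exists2 d, 0 < d &
    forall h t, `|h| < d -> `|t| < d ->
      `|f (x + h + t *: u) - f (x + h) - t *: z| <= e * (`|h| + `|t|).
Proof.
move=> /right_dirderiv_expansion[z fz]; exists z => e e0.
have [k [r [r0 fk]]] := lipschitz_at_bound x_lip.
have k0 : 0 <= k%:R :> R by [].
(* The estimate costs [(2 * k + 1) * eta * |t|] and replacing [z] by [E b] costs [eta / 2 * |t|];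
   together they stay below [e / 2 * |t|] when [t != 0]. *)
have [m me] : exists m : nat, m.+1%:R^-1 < e / (4 * (k%:R + 1)).
  by apply: exists_invS_lt; rewrite divr_gt0// mulr_gt0//; lra.
set eta := m.+1%:R^-1 in me.
have eta0 : 0 < eta by rewrite invr_gt0.
have keta : (4 * (k%:R + 1)) * eta < e.
  by rewrite mulrC -ltr_pdivlMr// mulr_gt0//; lra.
have eta20 : 0 < eta / 2 by rewrite divr_gt0.
have [s s0 fs] := fz _ eta20.
have [n] : exists n : nat, n.+1%:R^-1 < Num.min r s.
  by apply: exists_invS_lt; rewrite lt_min r0.
rewrite lt_min => /andP[nr ns].
have [a ua] := D_dense u eta0; have [b zb] := E_dense z eta20.
have zbt t : `|t *: z - t *: E b| <= `|t| * (eta / 2).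
  by rewrite -scalerBr normrZ ler_wpM2l// ltW.
have xC : controlled_piece (k, n, m, a, b) x.
  split=> [y yn|]; first by apply: fk; apply: lt_trans nr.
  exists u => [|t /andP[t0 tn]]; first exact: ltW.
  have [->|tn0] := eqVneq t 0.
    by rewrite !scale0r addr0 !subrr normr0 mulr0.
  have tgt0 : 0 < t by rewrite lt_neqAle eq_sym tn0.
  have ft : `|f (x + t *: u) - f x - t *: z| <= eta / 2 * t.
    by apply: fs; rewrite tgt0 (lt_trans tn).
  rewrite -(subrKA (t *: z)).
  apply: (le_trans (ler_normD _ _)); have := zbt t; rewrite ger0_norm//.
  by rewrite -/eta; lra.
have e20 : 0 < e / 2 by rewrite divr_gt0.
have n0 : 0 < n.+1%:R^-1 :> R by rewrite invr_gt0.
have [d d0 dh] := controlled_estimate n0 e20 xC (x_generic xC) (ltW ua).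
exists d => // h t hd td; have := dh h t hd td; rewrite -/eta => ht.
rewrite -(subrKA (t *: E b)).
apply: (le_trans (ler_normD _ _)); have := zbt t; rewrite distrC => tb.
have h0 := normr_ge0 h; have t0 := normr_ge0 t.
have : 4 * (k%:R + 1) * eta * `|t| <= e * `|t| by rewrite ler_wpM2r// ltW.
nra.
Qed.

(** Write [v = w + t *: u] and pass through [x + w]: the expansion along [W] handles the first leg,
    the increment formula with [h = w] the second. *)
Lemma expansion_along_adjoin_line W u : closed W -> submodule W -> ~ W u ->
  ex_right_dirderiv f x u ->
  expansion_along W f x -> expansion_along (adjoin_line W u) f x.
Proof.
move=> Wc Wm NWu /generic_increment[z fz] [T [Tlin fT]].
have [l [r [r0 Wl lE lr]]] := adjoin_line_coordinate Wc Wm NWu.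
have Vm := submodule_adjoin_line u Wm.
have l0 : l 0 = 0 by apply: lE; rewrite scale0r subr0; apply: Wm.1.
have coordE a v w : a *: v + w - (a * l v + l w) *: u =
    a *: (v - l v *: u) + (w - l w *: u).
  by rewrite scalerDl opprD addrACA scalerBr scalerA.
have lD a v w : adjoin_line W u v -> adjoin_line W u w ->
    l (a *: v + w) = a * l v + l w.
  by move=> Vv Vw; apply: lE; rewrite coordE; apply: Wm.2; apply: Wl.
exists (fun v => T (v - l v *: u) + l v *: z); split=> [a v w Vv Vw|e e0].
  rewrite lD// coordE Tlin; [|exact: Wl..].
  by rewrite scalerDl scalerDr scalerA addrACA.
(* From [|t| <= |v| / r] and [|w| <= |v| + |t| * |u|] one gets [|w| + |t| <= K * |v|]. *)
pose K := 1 + (1 + `|u|) / r.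
have K1 : 1 <= K by rewrite lerDl divr_ge0// ?ltW// addr_ge0.
have eK : 0 < e / (2 * K) by rewrite divr_gt0// mulr_gt0//; lra.
have [d1 d10 fd1] := fz _ eK; have [d2 d20 fd2] := fT _ eK.
exists (Num.min d1 d2 / K).
  by rewrite divr_gt0 ?lt_min ?d10//; lra.
move=> v Vv; rewrite ltr_pdivlMr ?lt_min; last by lra.
move=> /andP[vd1 vd2]; set t := l v; set w := v - t *: u.
have tv : `|t| <= `|v| / r.
  have := lr v 0 Vv Vm.1; rewrite l0 !subr0 => tr.
  by rewrite ler_pdivlMr// mulrC.
have wtv : `|w| + `|t| <= `|v| * K.
  have : `|w| <= `|v| + `|t| * `|u| by rewrite -normrZ; apply: ler_normB.
  have : `|t| * (1 + `|u|) <= `|v| / r * (1 + `|u|).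
    by rewrite ler_wpM2r// addr_ge0.
  by rewrite /K; lra.
have w0 := normr_ge0 w; have t0 := normr_ge0 t.
have := fd1 w t _ _; have := fd2 w (Wl _ Vv) _.
have -> : x + w + t *: u = x + v by rewrite -addrA subrK.
move=> /(_ ltac:(lra)) fw /(_ ltac:(lra) ltac:(lra)) ft.
have -> : f (x + v) - f x - (T w + t *: z) =
    (f (x + v) - f (x + w) - t *: z) + (f (x + w) - f x - T w).
  rewrite [f (x + v) - f (x + w) - _]addrAC -[f (x + w) - _ - _]addrA subrKA.
  by rewrite opprD [- T w - _]addrC addrACA.
apply: (le_trans (ler_normD _ _)).
have : e / (2 * K) * (2 * (`|w| + `|t|)) <= e / (2 * K) * (2 * (`|v| * K)).
  by rewrite ler_wpM2l ?(ltW eK)//; lra.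
have -> : e / (2 * K) * (2 * (`|v| * K)) = e * `|v|.
  by field; rewrite gt_eqF//; lra.
have : 0 <= e / (2 * K) * `|t| by rewrite mulr_ge0// ltW.
lra.
Qed.

Lemma expansion_along_full (S : set X) n (e : 'I_n -> X) W :
  dense (linear_span S) -> (forall u, S u -> ex_right_dirderiv f x u) ->
  closed W -> submodule W ->
  (forall y, exists c : 'I_n -> R, W (y - \sum_(i < n) c i *: e i)) ->
  expansion_along W f x -> expansion_along setT f x.
Proof.
move=> dS fS; elim: n e W => [|n IHn] e W Wc Wm We fW.
  rewrite (_ : setT = W)//; apply/seteqP; split=> // y _.
  by have [c] := We y; rewrite big_ord0 subr0.
have [WT|/existsNP[y NWy]] := pselect (forall y, W y).
  by rewrite (_ : setT = W)//; apply/seteqP; split.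
have [u Su NWu] : exists2 u, S u & ~ W u.
  apply: contrapT => /forall2NP NS.
  have [|v [NWv [m [c [s [Ss vE]]]]]] := dS (~` W) _ (closed_openC Wc).
    by exists y.
  apply/NWv/(linear_span_submodule Wm); exists m, c, s; split=> // i.
  by have [/(_ (Ss i))|/contrapT] := NS (s i).
have [c Wu] := We u.
have [j cj0] : exists j, c j != 0.
  apply: contrapT => /forallNP c0; apply: NWu; move: Wu.
  rewrite big1 ?subr0// => i _; have /negP/negPn/eqP -> := c0 i.
  by rewrite scale0r.
apply: (IHn (e \o lift j) (adjoin_line W u)).
- exact: closed_adjoin_line.
- exact: submodule_adjoin_line.
- move=> v; have [b Wv] := We v; pose s := b j / c j.
  (* Subtracting [s] times the relation for [u] cancels the coefficient of [e j]. *)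
  exists (fun i => b (lift j i) - s * c (lift j i)); exists s.
  have := submoduleB Wm Wv (submoduleZ s Wm Wu).
  congr (W _); rewrite scalerBr opprB addrA; congr (_ - _).
  rewrite -addrA; congr (_ + _); rewrite scaler_sumr !(bigD1_ord j)//=.
  rewrite scalerA divfK// opprD addrACA addNr add0r -!sumrN -big_split /=.
  by apply: eq_bigr => i _; rewrite scalerBl opprB scalerA addrC.
- exact: expansion_along_adjoin_line (fS _ Su) fW.
Qed.

End Increments.

(** * The exceptional set *)

Theorem proposition5p5 (R : realType) (X Y : completeNormedModType R)
    (hX0 : nontrivial_space X) (hY0 : nontrivial_space Y)
    (hX : separable_space X) (hY : separable_space Y)
    (G : set X) (hG : open G) (f : X -> Y) :
  exists A : set X, [/\ A `<=` G, sigma_porous A &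
    forall x : X, (G `\` A) x ->
      lipschitz_at f x ->
      (exists M : subspace X, finite_codim M /\ differentiable_along M f x) ->
      (exists S : set X, dense (linear_span S) /\
         forall u : X, S u -> ex_right_dirderiv f x u) ->
      differentiable f x].
Proof.
have [D D_dense] := separable_dense_sequence hX.
have [E E_dense] := separable_dense_sequence hY.
pose C := controlled_piece f D E.
(* Each piece contributes those of its points where it is porous. They form a porous set, since
   porosity at a point passes to subsets. *)
exists (\bigcup_i (G `&` [set x | C i x /\ porous_at (C i) x])); split.
- by move=> x [i _ []].
- apply: sigma_porous_bigcup => i x [_ [_ pC]].
  by apply: porous_at_subset pC => y [_ []].
move=> x [Gx NAx] x_lip [M [[n [e Me]] /differentiable_along_expansion fM]].
move=> [S [dS fS]]; apply: expansion_differentiable => //.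
have x_generic i : C i x -> ~ porous_at (C i) x.
  by move=> Cx pC; apply: NAx; exists i.
apply: (expansion_along_full D_dense E_dense x_lip x_generic dS fS) Me fM.
  exact: subspace_closed.
have [M0 MD] := subspace_submod M; split; first by have := M0; rewrite inE.
by move=> a v w Mv Mw; have := MD a v w; rewrite !inE; apply.
Qed.
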